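(* Let $X$ be a perfectly normal sequential space which contains a closed subspace homeomorphic to $K$ and a (not necessarily closed) subspace $V'\subset X$ homeomorphic to $V$; let $y_0'$ denote the unique non-isolated point of $V'$. Then: (a) $X$ is not homeomorphic to any closed convex subset of a (real) linear topological space; (b) $X$ is not homeomorphic to any closed multiplicative subset of a topological group; (c) there is no topological group $G$ with a multiplicative subset $M\subset G$ (with the subspace topology) and a homeomorphism $X\to M$ that sends $y_0'$ to an idempotent (i.e. to the identity element) of $G$.
   Context: $K=\{(0,0)\}\cup\{(\tfrac1n,\tfrac1{nm}) : n,m\in\mathbb N\}\subset\mathbb R^2$ with the subspace topology. Let $S_0=\{0\}\cup\{\tfrac1n:n\in\mathbb N\}\subset\mathbb R$ and let $V$ (the Fréchet–Urysohn fan) be the quotient space $(\mathbb N\times S_0)/(\mathbb N\times\{0\})$, where $\mathbb N$ is discrete, i.e. $\mathbb N\times S_0$ with the subset $\mathbb N\times\{0\}$ collapsed to a single point; $V$ has exactly one non-isolated point. A subset $A$ of a topological group $G$ is multiplicative if $a\ast b\in A$ for all $a,b\in A$, where $\ast$ is the group operation. A space is sequential if every sequentially closed set is closed. *)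

(* Defs.v *)
From Stdlib Require Import Reals Lra.
Open Scope R_scope.

Definition topology (T : Type) := (T -> Prop) -> Prop.

Definition is_topology {T : Type} (op : topology T) : Prop :=
  op (fun _ => True) /\
  (forall U V, op U -> op V -> op (fun x => U x /\ V x)) /\
  (forall F : (T -> Prop) -> Prop, (forall U, F U -> op U) ->
     op (fun x => exists U, F U /\ U x)).

Definition closed {T : Type} (op : topology T) (A : T -> Prop) : Prop :=
  op (fun x => ~ A x).

Definition continuous {T1 T2 : Type} (op1 : topology T1) (op2 : topology T2)
  (f : T1 -> T2) : Prop :=
  forall W, op2 W -> op1 (fun x => W (f x)).

Definition is_homeomorphism {T1 T2 : Type} (op1 : topology T1) (op2 : topology T2)
  (f : T1 -> T2) : Prop :=
  exists g : T2 -> T1,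
    (forall x, g (f x) = x) /\ (forall y, f (g y) = y) /\
    continuous op1 op2 f /\ continuous op2 op1 g.

Definition homeomorphic {T1 T2 : Type} (op1 : topology T1) (op2 : topology T2) : Prop :=
  exists f : T1 -> T2, is_homeomorphism op1 op2 f.

Definition sub_open {T : Type} (op : topology T) (A : T -> Prop) : topology {x | A x} :=
  fun U => exists W, op W /\ forall x : {x | A x}, U x <-> W (proj1_sig x).

Definition prod_open {T1 T2 : Type} (op1 : topology T1) (op2 : topology T2)
  : topology (T1 * T2) :=
  fun W => forall p, W p -> exists U V, op1 U /\ op2 V /\ U (fst p) /\ V (snd p) /\
      forall q, U (fst q) -> V (snd q) -> W q.

Definition quot_open {T Q : Type} (op : topology T) (q : T -> Q) : topology Q :=
  fun U => op (fun x => U (q x)).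

Definition R_open : topology R :=
  fun U => forall x, U x -> exists eps, eps > 0 /\ forall y, Rabs (y - x) < eps -> U y.

Definition nat_open : topology nat := fun _ => True.

Definition R2_open : topology (R * R) := prod_open R_open R_open.

(** The space K (as a subspace of R^2). N = {1,2,...}. *)
Definition K_set (p : R * R) : Prop :=
  p = (0, 0) \/
  exists n m : nat, p = (1 / INR (S n), 1 / (INR (S n) * INR (S m))).

Definition K_top : topology {p | K_set p} := sub_open R2_open K_set.

Definition S0_set (x : R) : Prop := x = 0 \/ exists n : nat, x = 1 / INR (S n).
Definition S0 := {x | S0_set x}.
Definition S0_top : topology S0 := sub_open R_open S0_set.
Definition S0_zero : S0 := exist S0_set 0 (or_introl eq_refl).

Definition NS0 := (nat * S0)%type.
Definition NS0_top : topology NS0 := prod_open nat_open S0_top.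

Definition V_rel (p q : NS0) : Prop :=
  p = q \/ (proj1_sig (snd p) = 0 /\ proj1_sig (snd q) = 0).

Definition V_carrier := {P : NS0 -> Prop | exists p, P = V_rel p}.
Definition V_cls (p : NS0) : V_carrier :=
  exist (fun P => exists p, P = V_rel p) (V_rel p) (ex_intro _ p eq_refl).

Definition V_top : topology V_carrier := quot_open NS0_top V_cls.

(** Its unique non-isolated point (the image of N x {0}). *)
Definition V_inf : V_carrier := V_cls (O, S0_zero).

Definition T1_space {T : Type} (op : topology T) : Prop :=
  forall x : T, closed op (fun y => y = x).

Definition normal_space {T : Type} (op : topology T) : Prop :=
  T1_space op /\
  forall A B, closed op A -> closed op B -> (forall x, A x -> B x -> False) ->
    exists U V, op U /\ op V /\ (forall x, A x -> U x) /\ (forall x, B x -> V x) /\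
      (forall x, U x -> V x -> False).

Definition G_delta {T : Type} (op : topology T) (A : T -> Prop) : Prop :=
  exists U : nat -> T -> Prop, (forall n, op (U n)) /\ forall x, A x <-> forall n, U n x.

Definition perfectly_normal {T : Type} (op : topology T) : Prop :=
  normal_space op /\ forall A, closed op A -> G_delta op A.

Definition seq_converges {T : Type} (op : topology T) (s : nat -> T) (x : T) : Prop :=
  forall U, op U -> U x -> exists N, forall n, (N <= n)%nat -> U (s n).

Definition seq_closed {T : Type} (op : topology T) (A : T -> Prop) : Prop :=
  forall (s : nat -> T) x, (forall n, A (s n)) -> seq_converges op s x -> A x.

Definition sequential_space {T : Type} (op : topology T) : Prop :=
  forall A, seq_closed op A -> closed op A.

Definition is_real_vector_space {L : Type} (add : L -> L -> L) (zero : L)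
  (opp : L -> L) (scal : R -> L -> L) : Prop :=
  (forall x y z, add x (add y z) = add (add x y) z) /\
  (forall x y, add x y = add y x) /\
  (forall x, add zero x = x) /\
  (forall x, add (opp x) x = zero) /\
  (forall a b x, scal a (scal b x) = scal (a * b) x) /\
  (forall x, scal 1 x = x) /\
  (forall a x y, scal a (add x y) = add (scal a x) (scal a y)) /\
  (forall a b x, scal (a + b) x = add (scal a x) (scal b x)).

Definition is_linear_topological_space {L : Type} (add : L -> L -> L) (zero : L)
  (opp : L -> L) (scal : R -> L -> L) (op : topology L) : Prop :=
  is_real_vector_space add zero opp scal /\ is_topology op /\
  continuous (prod_open op op) op (fun p => add (fst p) (snd p)) /\
  continuous (prod_open R_open op) op (fun p => scal (fst p) (snd p)).

Definition convex {L : Type} (add : L -> L -> L) (scal : R -> L -> L) (C : L -> Prop) : Prop :=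
  forall x y t, C x -> C y -> 0 <= t <= 1 -> C (add (scal t x) (scal (1 - t) y)).

Definition is_group {G : Type} (mul : G -> G -> G) (one : G) (inv : G -> G) : Prop :=
  (forall x y z, mul x (mul y z) = mul (mul x y) z) /\
  (forall x, mul one x = x) /\ (forall x, mul x one = x) /\
  (forall x, mul (inv x) x = one) /\ (forall x, mul x (inv x) = one).

Definition is_topological_group {G : Type} (mul : G -> G -> G) (one : G) (inv : G -> G)
  (op : topology G) : Prop :=
  is_group mul one inv /\ is_topology op /\
  continuous (prod_open op op) op (fun p => mul (fst p) (snd p)) /\
  continuous op op inv.

Definition multiplicative {G : Type} (mul : G -> G -> G) (A : G -> Prop) : Prop :=
  forall a b, A a -> A b -> A (mul a b).

(* Main.v *)
(** Write [x_{n,m}] for the points of the closed copy of [K] and [y_{n,m}] for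
    those of the fan, with limits [x_0] and [y_0], and let [x * y] be the group
    product in (b), (c) and the midpoint in (a).  The set of all
    [x_{n,m} * y_{n,m}] accumulates at [x_0 * y_0], yet, once finitely many
    points of each fan column are dropped, no sequence in it has a limit outside
    of it.  Indeed along a sequence with [n] bounded and [m -> oo] cancelling
    [y_{n,m}] would make [x_{n,m}] converge, and along one with [n -> oo]
    cancelling [x_{n,m}] would make [y_{n,m}] converge to [y_0], which the
    topology of the fan forbids.  Dropping points serves to identify the limit
    in the second case: points of [X] are G-delta in a regular space, and
    column [n] is pushed into the [n]-th neighbourhood of [x_0 * y_0]. *)

Require Import Defs.
From Stdlib Require Import Reals.
From Stdlib Require Import Lra Lia Classical FunctionalExtensionality
  PropExtensionality IndefiniteDescription.
Open Scope R_scope.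

(** * Index sequences, subsequences and limits *)

Definition diverges (a : nat -> nat) : Prop :=
  forall N, exists k0, forall k, (k0 <= k)%nat -> (N <= a k)%nat.

Lemma diverges_ge (a : nat -> nat) : (forall k, (k <= a k)%nat) -> diverges a.
Proof. intros H N; exists N; intros k Hk; specialize (H k); lia. Qed.

(** Failing to diverge means dropping below some bound infinitely often, and one of the finitely
    many values below it must then recur. *)
Lemma diverges_or_constant_subseq (a : nat -> nat) :
  diverges a \/
  exists n sigma, (forall k, (k <= sigma k)%nat) /\ forall k, a (sigma k) = n.
Proof.
  destruct (classic (diverges a)) as [H|H]; [now left|right].
  apply not_all_ex_not in H; destruct H as [N HN].
  assert (Hinf : forall k0, exists k, (k0 <= k)%nat /\ (a k < N)%nat).
  { intros k0; apply NNPP; intros Hk; apply HN; exists k0; intros k Hle.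
    destruct (Nat.le_gt_cases N (a k)); auto.
    exfalso; apply Hk; exists k; auto. }
  assert (Hn : exists n, forall k0, exists k, (k0 <= k)%nat /\ a k = n).
  { clear HN; induction N as [|N IH].
    - destruct (Hinf 0%nat) as [k [_ Hk]]; lia.
    (* Either the top value [N] recurs, or it stops occurring from [k1] on and the bound improves
       from [S N] to [N]. *)
    - destruct (classic (forall k0, exists k, (k0 <= k)%nat /\ a k = N)) as [E|E];
        [now exists N|].
      apply not_all_ex_not in E; destruct E as [k1 E].
      apply IH; intros k0; destruct (Hinf (k0 + k1)%nat) as [k [Hk Ha]].
      exists k; split; [lia|].
      assert (a k <> N) by (intros Ek; apply E; exists k; split; [lia|auto]).
      lia. }
  destruct Hn as [n Hn].
  destruct (functional_choice _ Hn) as [sigma Hs].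
  exists n, sigma; split; intros k; apply Hs.
Qed.

Lemma seq_converges_subseq {T : Type} (op : topology T) s x a :
  seq_converges op s x -> diverges a -> seq_converges op (fun k => s (a k)) x.
Proof.
  intros Hs Ha U HU Ux; destruct (Hs U HU Ux) as [N HN].
  destruct (Ha N) as [k0 Hk]; exists k0; auto.
Qed.

Lemma seq_converges_eventually_const {T : Type} (op : topology T) s x N :
  (forall n, (N <= n)%nat -> s n = x) -> seq_converges op s x.
Proof. intros H U _ Ux; exists N; intros n Hn; rewrite H; auto. Qed.

Lemma seq_converges_ext {T : Type} (op : topology T) s t x :
  (forall k, s k = t k) -> seq_converges op s x -> seq_converges op t x.
Proof.
  intros E Hs U HU Ux; destruct (Hs U HU Ux) as [N HN].
  exists N; intros n Hn; rewrite <- E; auto.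
Qed.

Lemma T1_limit_const {T : Type} (op : topology T) :
  T1_space op -> forall x z, seq_converges op (fun _ => x) z -> z = x.
Proof.
  intros HT x z Hx; apply NNPP; intros Hne.
  destruct (Hx _ (HT x) Hne) as [N HN]; exact (HN N (le_n _) eq_refl).
Qed.

Lemma set_ext {T : Type} (A B : T -> Prop) : (forall x, A x <-> B x) -> A = B.
Proof.
  intros H; apply functional_extensionality; intros x.
  apply propositional_extensionality; apply H.
Qed.

Lemma closed_seq {T : Type} (op : topology T) A s x :
  closed op A -> (forall n, A (s n)) -> seq_converges op s x -> A x.
Proof.
  intros HA Hs Hx; apply NNPP; intros Hn.
  destruct (Hx _ HA Hn) as [N HN]; exact (HN N (le_n _) (Hs N)).
Qed.

(** * Jointly continuous operations, and points of perfectly normal spaces *)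

Definition continuous2 {T1 T2 T3 : Type} (op1 : topology T1) (op2 : topology T2)
  (op3 : topology T3) (f : T1 -> T2 -> T3) : Prop :=
  forall x y W, op3 W -> W (f x y) -> exists U V, op1 U /\ op2 V /\ U x /\ V y /\
    forall x' y', U x' -> V y' -> W (f x' y').

Lemma continuous2_curry {T1 T2 T3 : Type} (op1 : topology T1) (op2 : topology T2)
  (op3 : topology T3) (f : T1 -> T2 -> T3) :
  continuous (prod_open op1 op2) op3 (fun p => f (fst p) (snd p)) ->
  continuous2 op1 op2 op3 f.
Proof.
  intros Hf x y W HW Wf.
  destruct (Hf W HW (x, y) Wf) as (U & V & HU & HV & Ux & Vy & H).
  exists U, V; repeat split; auto.
  intros x' y' Ux' Vy'; exact (H (x', y') Ux' Vy').
Qed.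

Lemma continuous2_seq {T1 T2 T3 : Type} (op1 : topology T1) (op2 : topology T2)
  (op3 : topology T3) (f : T1 -> T2 -> T3) u v x y :
  continuous2 op1 op2 op3 f -> seq_converges op1 u x -> seq_converges op2 v y ->
  seq_converges op3 (fun k => f (u k) (v k)) (f x y).
Proof.
  intros Hf Hu Hv W HW Wf.
  destruct (Hf x y W HW Wf) as (U & V & HU & HV & Ux & Vy & H).
  destruct (Hu U HU Ux) as [N1 H1], (Hv V HV Vy) as [N2 H2].
  exists (N1 + N2)%nat; intros n Hn; apply H; [apply H1|apply H2]; lia.
Qed.

Lemma seq_converges_const {T : Type} (op : topology T) x :
  seq_converges op (fun _ => x) x.
Proof. apply seq_converges_eventually_const with 0%nat; auto. Qed.

(** Normality separates [p] from the complement of each [O i], which puts the closure of [U i]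
    inside [O i]. A limit of a sequence that is eventually in every [U i] then lies in all the
    [O i], whose intersection is [p] alone. *)
Lemma perfectly_normal_point {T : Type} (op : topology T) (p : T) :
  perfectly_normal op ->
  exists U : nat -> T -> Prop, (forall i, op (U i) /\ U i p) /\
    forall s z, (forall i, exists N, forall k, (N <= k)%nat -> U i (s k)) ->
      seq_converges op s z -> z = p.
Proof.
  intros [[HT1 Hn] HG].
  destruct (HG _ (HT1 p)) as [O [HO Hp]].
  assert (H : forall i, exists U : T -> Prop, op U /\ U p /\
    exists V, op V /\ (forall x, ~ O i x -> V x) /\ forall x, U x -> V x -> False).
  { intros i.
    destruct (Hn (fun y => y = p) (fun y => ~ O i y)) as (U & V & HU & HV & Up & VO & D).
    - apply HT1.
    - unfold closed; rewrite (set_ext _ (O i)); auto.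
      intros x; split; [apply NNPP|auto].
    - intros x -> Hx; apply Hx, Hp; reflexivity.
    - exists U; repeat split; auto; exists V; auto. }
  destruct (functional_choice _ H) as [U HU].
  exists U; split; [intros i; destruct (HU i) as (?&?&?); auto|].
  intros s z Hs Hz; apply Hp; intros i; apply NNPP; intros HzO.
  destruct (HU i) as (_ & _ & V & HV & VO & D).
  destruct (Hs i) as [N1 H1], (Hz V HV (VO z HzO)) as [N2 H2].
  apply (D (s (N1 + N2)%nat)); [apply H1|apply H2]; lia.
Qed.

(** * Reciprocals, and convergence in the fan *)

Lemma inv_succ_pos m : 0 < 1 / INR (S m).
Proof. apply Rdiv_lt_0_compat; [lra|apply lt_0_INR; lia]. Qed.

Lemma inv_succ_small eps : 0 < eps ->
  exists N, forall m, (N <= m)%nat -> 1 / INR (S m) < eps.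
Proof.
  intros He; destruct (archimed_cor1 eps He) as [N [HN Hp]].
  exists N; intros m Hm; apply Rle_lt_trans with (/ INR N); auto.
  unfold Rdiv; rewrite Rmult_1_l; apply Rinv_le_contravar.
  - now apply lt_0_INR.
  - apply le_INR; lia.
Qed.

Lemma R_open_lt c : R_open (fun x => x < c).
Proof.
  intros x Hx; exists (c - x); split; [lra|].
  intros y Hy; apply Rabs_def2 in Hy; lra.
Qed.

Lemma R_open_gt c : R_open (fun x => c < x).
Proof.
  intros x Hx; exists (x - c); split; [lra|].
  intros y Hy; apply Rabs_def2 in Hy; lra.
Qed.

Definition S0_point (m : nat) : S0 :=
  exist S0_set (1 / INR (S m)) (or_intror (ex_intro _ m eq_refl)).

Lemma V_cls_zero n : V_cls (n, S0_zero) = V_inf.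
Proof.
  assert (E : V_rel (n, S0_zero) = V_rel (0%nat, S0_zero)).
  { apply set_ext; intros q; unfold V_rel; split; (intros [<-|[H1 H2]];
      [right; simpl; auto|right; simpl; auto]). }
  unfold V_inf, V_cls.
  (* Abstracting the existence proofs keeps the rewriting by [E] well typed; proof irrelevance then
     identifies them. *)
  generalize (ex_intro (fun p => V_rel (n, S0_zero) = V_rel p) (n, S0_zero) eq_refl).
  generalize (ex_intro (fun p => V_rel (0%nat, S0_zero) = V_rel p) (0%nat, S0_zero) eq_refl).
  rewrite E; intros e1 e2; f_equal; apply proof_irrelevance.
Qed.

Lemma fan_column_converges n :
  seq_converges V_top (fun m => V_cls (n, S0_point m)) V_inf.
Proof.
  (* Openness in the quotient is tested at a representative; taking [(n, S0_zero)] gives a product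
     neighbourhood that meets column [n]. *)
  intros U HU Hinf; rewrite <- (V_cls_zero n) in Hinf.
  destruct (HU (n, S0_zero) Hinf) as (A & B & _ & [B' [HB' HB]] & An & B0 & H).
  apply HB in B0; destruct (HB' _ B0) as [eps [He Hb]].
  destruct (inv_succ_small eps He) as [N HN].
  exists N; intros m Hm; apply (H (n, S0_point m)); simpl; auto.
  apply HB, Hb; change (Rabs (1 / INR (S m) - 0) < eps).
  rewrite Rminus_0_r, Rabs_right; auto.
  apply Rle_ge, Rlt_le, inv_succ_pos.
Qed.

(** Each column contains only finitely many terms, so a neighbourhood of [V_inf] can pass below all
    of them. *)
Lemma fan_no_transversal_limit (a b : nat -> nat) : diverges a ->
  ~ seq_converges V_top (fun k => V_cls (a k, S0_point (b k))) V_inf.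
Proof.
  intros Ha Hlim.
  set (W := fun q : NS0 => exists eps, proj1_sig (snd q) < eps /\
              forall k, a k = fst q -> eps <= 1 / INR (S (b k))).
  assert (W0 : forall q, proj1_sig (snd q) = 0 -> W q).
  { intros [n s] Hs; simpl in Hs; unfold W; simpl; rewrite Hs.
    (* From [k0] on the sequence has left column [n], so [eps] is a minimum over finitely many
       terms; it starts at 1 for the case of none. *)
    destruct (Ha (S n)) as [k0 Hk0].
    assert (E : exists eps, 0 < eps /\
                  forall k, (k < k0)%nat -> eps <= 1 / INR (S (b k))).
    { clear; induction k0 as [|k0 [eps [He IH]]].
      - exists 1; split; [lra|lia].
      - exists (Rmin eps (1 / INR (S (b k0)))); split.
        + apply Rmin_glb_lt; auto; apply inv_succ_pos.
        + intros k Hk; destruct (Nat.eq_dec k k0) as [->|Hne]; [apply Rmin_r|].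
          eapply Rle_trans; [apply Rmin_l|apply IH; lia]. }
    destruct E as [eps [He E]]; exists eps; split; auto.
    intros k Hk; apply E; destruct (Nat.lt_ge_cases k k0); auto.
    specialize (Hk0 k H); lia. }
  (* Quantifying over all representatives avoids choosing one; for the collapsed class they all lie
     in [W] by [W0]. *)
  set (U := fun v : V_carrier => forall q, proj1_sig v q -> W q).
  assert (HU : V_top U).
  { intros [n s] Hu; destruct (Hu (n, s) (or_introl eq_refl)) as [eps [He Hk]].
    simpl in He, Hk.
    exists (fun j => j = n), (fun t : S0 => proj1_sig t < eps); repeat split; auto.
    - exists (fun x => x < eps); split; [apply R_open_lt|intros x; tauto].
    - intros [n' t] Hn Ht q [<-|[_ Hq]]; [|auto].
      simpl in Hn, Ht; subst n'; exists eps; auto. }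
  assert (U0 : U V_inf).
  { intros q [<-|[_ Hq]]; apply W0; auto. }
  destruct (Hlim U HU U0) as [N HN].
  destruct (HN N (le_n _) _ (or_introl eq_refl)) as [eps [He Hk]].
  exact (Rlt_not_le _ _ He (Hk N eq_refl)).
Qed.

(** * Columns of [K]: they shrink to the origin, and none has a limit in [K] *)

Definition K_point (n m : nat) : {p | K_set p} :=
  exist K_set (1 / INR (S n), 1 / (INR (S n) * INR (S m)))
    (or_intror (ex_intro _ n (ex_intro _ m eq_refl))).

Definition K_zero : {p | K_set p} := exist K_set (0, 0) (or_introl eq_refl).

Lemma K_point_snd n m :
  1 / (INR (S n) * INR (S m)) = 1 / INR (S n) * (1 / INR (S m)).
Proof. field; split; apply not_0_INR; lia. Qed.

Lemma inv_succ_le_1 m : 1 / INR (S m) <= 1.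
Proof.
  apply Rmult_le_reg_r with (INR (S m)); [apply lt_0_INR; lia|].
  unfold Rdiv; rewrite Rmult_assoc, Rinv_l by (apply not_0_INR; lia).
  pose proof (le_INR 1 (S m) ltac:(lia)) as H; change (INR 1) with 1 in H; lra.
Qed.

(** Both coordinates of a point of column [n] are at most [1 / INR (S n)], hence the uniformity in
    [m]. *)
Lemma K_columns_converge U : K_top U -> U K_zero ->
  exists N, forall n m, (N <= n)%nat -> U (K_point n m).
Proof.
  intros [W [HW HU]] U0; apply HU in U0.
  destruct (HW _ U0) as (A & B & HA & HB & A0 & B0 & H); simpl in A0, B0.
  destruct (HA 0 A0) as [e1 [He1 H1]], (HB 0 B0) as [e2 [He2 H2]].
  destruct (inv_succ_small (Rmin e1 e2)) as [N HN]; [now apply Rmin_glb_lt|].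
  exists N; intros n m Hn; apply HU; specialize (HN n Hn).
  pose proof (Rmin_l e1 e2); pose proof (Rmin_r e1 e2).
  pose proof (inv_succ_pos n); pose proof (inv_succ_pos m); pose proof (inv_succ_le_1 m).
  apply H; [apply H1|apply H2].
  - change (Rabs (1 / INR (S n) - 0) < e1); rewrite Rminus_0_r, Rabs_right; lra.
  - change (Rabs (1 / (INR (S n) * INR (S m)) - 0) < e2).
    rewrite K_point_snd, Rminus_0_r, Rabs_right; [nra|].
    apply Rle_ge, Rmult_le_pos; lra.
Qed.

(** In the plane the sequence tends to [(1 / INR (S n), 0)], which is not in [K]. The first
    coordinate rules out the origin as a limit, the second every other point of [K]. *)
Lemma K_column_no_limit n b z : diverges b ->
  ~ seq_converges K_top (fun k => K_point n (b k)) z.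
Proof.
  intros Hb Hz; destruct z as [z [Ez|[n' [m' Ez]]]].
  - destruct (Hz (fun p => fst (proj1_sig p) < 1 / INR (S n))) as [N HN].
    + exists (fun p => fst p < 1 / INR (S n)); split; [|intros x; tauto].
      intros p Hp; exists (fun x => x < 1 / INR (S n)), (fun _ => True).
      repeat split; auto; [apply R_open_lt|intros x _; exists 1; split; [lra|auto]].
    + subst z; simpl; apply inv_succ_pos.
    + exact (Rlt_irrefl _ (HN N (le_n _))).
  (* Half the second coordinate of [z], below which the sequence eventually falls. *)
  - set (c := 1 / INR (S n') * (1 / INR (S m')) / 2).
    assert (Hc : 0 < c).
    { unfold c; pose proof (Rmult_lt_0_compat _ _ (inv_succ_pos n') (inv_succ_pos m')); lra. }
    destruct (Hz (fun p => c < snd (proj1_sig p))) as [N HN].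
    + exists (fun p => c < snd p); split; [|intros x; tauto].
      intros p Hp; exists (fun _ => True), (fun x => c < x).
      repeat split; auto; [intros x _; exists 1; split; [lra|auto]|apply R_open_gt].
    + subst z; change (c < 1 / (INR (S n') * INR (S m'))).
      rewrite K_point_snd; unfold c in *; lra.
    + destruct (inv_succ_small c Hc) as [N1 H1]; destruct (Hb N1) as [k0 Hk0].
      specialize (HN (N + k0)%nat ltac:(lia)).
      change (c < 1 / (INR (S n) * INR (S (b (N + k0)%nat)))) in HN.
      rewrite K_point_snd in HN.
      specialize (H1 (b (N + k0)%nat) (Hk0 (N + k0)%nat ltac:(lia))).
      pose proof (inv_succ_le_1 n); pose proof (inv_succ_pos n).
      pose proof (inv_succ_pos (b (N + k0)%nat)); nra.
Qed.

(** * Copies of the fan and of [K], and their conflict with a cancellative operation *)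

(** Open sets of a subspace are traces of ambient ones, so convergence to a point of the subspace
    can be tested in the ambient space. *)
Lemma homeo_sub_converges {T Y : Type} (opT : topology T) (opY : topology Y)
  (M : Y -> Prop) (h : T -> {y | M y}) :
  is_homeomorphism opT (sub_open opY M) h ->
  forall s z, seq_converges opT s z <->
    seq_converges opY (fun k => proj1_sig (h (s k))) (proj1_sig (h z)).
Proof.
  intros (g & gh & hg & ch & cg) s z; split; intros Hs U HU Uz.
  - apply (Hs (fun x => U (proj1_sig (h x)))); auto.
    apply (ch (fun y => U (proj1_sig y))); exists U; split; [auto|tauto].
  - destruct (cg U HU) as [W [HW HUW]].
    destruct (Hs W HW) as [N HN]; [apply HUW; rewrite gh; auto|].
    exists N; intros n Hn; rewrite <- (gh (s n)); apply HUW; auto.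
Qed.

Lemma fan_copy {X : Type} (opX : topology X) (V' : X -> Prop)
  (phi : V_carrier -> {x | V' x}) :
  is_homeomorphism V_top (sub_open opX V') phi ->
  exists y : nat -> nat -> X,
    (forall n, seq_converges opX (y n) (proj1_sig (phi V_inf))) /\
    forall a b, diverges a ->
      ~ seq_converges opX (fun k => y (a k) (b k)) (proj1_sig (phi V_inf)).
Proof.
  intros Hphi; exists (fun n m => proj1_sig (phi (V_cls (n, S0_point m)))); split.
  - intros n; exact (proj1 (homeo_sub_converges _ _ _ _ Hphi _ _) (fan_column_converges n)).
  - intros a b Ha Hs; apply (fan_no_transversal_limit a b Ha).
    now apply (homeo_sub_converges _ _ _ _ Hphi).
Qed.

(** Closedness of [C] forces any limit in [X] of a column into the copy, where [K] has none to
    offer. *)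
Lemma closed_K_copy {X : Type} (opX : topology X) (C : X -> Prop) :
  closed opX C -> homeomorphic (sub_open opX C) K_top ->
  exists (x : nat -> nat -> X) (x0 : X),
    (forall U, opX U -> U x0 -> exists N, forall n m, (N <= n)%nat -> U (x n m)) /\
    (forall n b z, diverges b -> ~ seq_converges opX (fun k => x n (b k)) z).
Proof.
  intros HC (f & g & gf & fg & cf & cg).
  assert (Hg : is_homeomorphism K_top (sub_open opX C) g) by (exists f; auto).
  exists (fun n m => proj1_sig (g (K_point n m))), (proj1_sig (g K_zero)); split.
  - intros U HU U0.
    apply (K_columns_converge (fun p => U (proj1_sig (g p)))); auto.
    apply (cg (fun y => U (proj1_sig y))); exists U; split; [auto|tauto].
  - intros n b z Hb Hz.
    assert (Cz : C z).
    { eapply closed_seq; [exact HC| |exact Hz]; intros k; exact (proj2_sig (g _)). }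
    apply (K_column_no_limit n b (f (exist _ z Cz)) Hb).
    apply (homeo_sub_converges _ _ _ _ Hg); rewrite gf; exact Hz.
Qed.

(* [cancel_r], the only law that depends on [y0], is where closedness (or
   [y0 = 1]) enters in the applications. *)
Lemma no_cancellative_operation {X : Type} (opX : topology X) (C V' : X -> Prop)
  (phi : V_carrier -> {x | V' x}) (mu : X -> X -> X) :
  let y0 := proj1_sig (phi V_inf) in
  perfectly_normal opX -> sequential_space opX ->
  closed opX C -> homeomorphic (sub_open opX C) K_top ->
  is_homeomorphism V_top (sub_open opX V') phi ->
  continuous2 opX opX opX mu ->
  forall (cancel_r : forall u v z, seq_converges opX (fun k => mu (u k) (v k)) z ->
    seq_converges opX v y0 -> exists x, seq_converges opX u x)
  (replace_l : forall u v x z, seq_converges opX (fun k => mu (u k) (v k)) z ->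
    seq_converges opX u x -> seq_converges opX (fun k => mu x (v k)) z)
  (cancel_l : forall v x y, seq_converges opX (fun k => mu x (v k)) (mu x y) ->
    seq_converges opX v y),
  False.
Proof.
  intros y0 pn sq HC HK Hphi cmu cancel_r replace_l cancel_l.
  destruct (closed_K_copy opX C HC HK) as (x & x0 & K1 & K2).
  destruct (fan_copy opX V' phi Hphi) as (y & F1 & F2); fold y0 in F1, F2.
  set (p := mu x0 y0).
  destruct (perfectly_normal_point opX p pn) as [U [HU Ulim]].
  (* The first clause holds for all but finitely many [m] in each column and will identify limits as
     [p]; the second keeps [p] out of [A]. *)
  set (good := fun n m => (forall i, (i <= n)%nat -> U i (mu x0 (y n m))) /\
                          mu (x n m) (y n m) <> p).
  set (A := fun w => exists n m, good n m /\ w = mu (x n m) (y n m)).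
  (* The right factors tend to [y0], so [cancel_r] would give the left ones a limit, against
     [K2]. *)
  assert (no_column : forall n b z, diverges b ->
    ~ seq_converges opX (fun k => mu (x n (b k)) (y n (b k))) z).
  { intros n b z Hb Hz.
    destruct (cancel_r _ _ _ Hz (seq_converges_subseq _ _ _ _ (F1 n) Hb)) as [w Hw].
    exact (K2 n b w Hb Hw). }
  assert (HA : closed opX A).
  { apply sq; intros s z Hs Hz.
    assert (Hab : forall k, exists ab : nat * nat, good (fst ab) (snd ab) /\
              s k = mu (x (fst ab) (snd ab)) (y (fst ab) (snd ab))).
    { intros k; destruct (Hs k) as (n & m & H); exists (n, m); exact H. }
    destruct (functional_choice _ Hab) as [ab H].
    set (a := fun k => fst (ab k)); set (b := fun k => snd (ab k)).
    assert (Es : forall k, s k = mu (x (a k) (b k)) (y (a k) (b k)))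
      by (intros k; apply H).
    destruct (diverges_or_constant_subseq a) as [Ha|(n & sigma & Hsig & Ea)].
    - exfalso; apply (seq_converges_ext _ _ _ _ Es) in Hz.
      assert (Hx : seq_converges opX (fun k => x (a k) (b k)) x0).
      { intros W HW W0; destruct (K1 W HW W0) as [N HN].
        destruct (Ha N) as [k0 Hk0]; exists k0; auto. }
      pose proof (replace_l _ _ _ _ Hz Hx) as Hy.
      (* For fixed [i], [good] puts the term in [U i] as soon as [a k] reaches [i], so [Ulim]
         applies. *)
      assert (z = p).
      { eapply Ulim; [|exact Hy]; intros i; destruct (Ha i) as [k0 Hk0].
        exists k0; intros k Hk; apply (H k); exact (Hk0 k Hk). }
      subst z; exact (F2 a b Ha (cancel_l _ _ _ Hy)).
    - pose proof (seq_converges_subseq _ _ _ _ Hz (diverges_ge _ Hsig)) as Hz'.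
      destruct (diverges_or_constant_subseq (fun k => b (sigma k)))
        as [Hb|(m & tau & Htau & Eb)].
      + exfalso; apply (no_column n _ z Hb); refine (seq_converges_ext _ _ _ _ _ Hz').
        intros k; rewrite Es, Ea; reflexivity.
      + assert (E : forall k, s (sigma (tau k)) = mu (x n m) (y n m)).
        { intros k; rewrite Es, Ea, Eb; reflexivity. }
        pose proof (seq_converges_subseq _ _ _ _ Hz' (diverges_ge _ Htau)) as Hz''.
        apply (seq_converges_ext _ _ (fun _ => mu (x n m) (y n m)) _ E) in Hz''.
        apply (T1_limit_const opX (proj1 (proj1 pn))) in Hz''; subst z.
        rewrite <- (E 0%nat); apply Hs. }
  assert (nAp : ~ A p).
  { intros (n & m & [_ Hne] & E); auto. }
  destruct (cmu x0 y0 _ HA nAp) as (P & Q & HP & HQ & Px & Qy & HPQ).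
  (* One column lying entirely in [P] suffices; from here on only [m] varies. *)
  destruct (K1 P HP Px) as [n Hn].
  assert (Hgood : exists m0, forall m, (m0 <= m)%nat ->
            Q (y n m) /\ forall i, (i <= n)%nat -> U i (mu x0 (y n m))).
  { destruct (F1 n Q HQ Qy) as [N HN].
    (* The [U i] need not be nested, so the first [j + 1] of them are handled one by one. *)
    assert (HI : forall j, exists M, forall m, (M <= m)%nat ->
              forall i, (i <= j)%nat -> U i (mu x0 (y n m))).
    { pose proof (continuous2_seq _ _ _ _ _ _ _ _ cmu
                    (seq_converges_const opX x0) (F1 n)) as Hm.
      induction j as [|j [M IH]].
      - destruct (Hm (U 0%nat)) as [M HM]; [apply HU|apply HU|].
        exists M; intros m Hm' i Hi; replace i with 0%nat by lia; auto.
      - destruct (Hm (U (S j))) as [M' HM']; [apply HU|apply HU|].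
        exists (M + M')%nat; intros m Hm' i Hi.
        destruct (Nat.eq_dec i (S j)) as [->|]; [apply HM'; lia|apply IH; lia]. }
    destruct (HI n) as [M HM]; exists (N + M)%nat; intros m Hm.
    split; [apply HN; lia|apply HM; lia]. }
  destruct Hgood as [m0 Hm0].
  (* A product other than [p] would be in [A], which [HPQ] forbids for large [m]. The column of
     products is thus eventually constant at [p], although it can have no limit. *)
  apply (no_column n (fun k => k) p (diverges_ge _ le_n)).
  apply (seq_converges_eventually_const _ _ _ m0); intros m Hm.
  destruct (Hm0 m Hm) as [HQm HUm]; apply NNPP; intros Hne.
  apply (HPQ (x n m) (y n m)); auto.
  exists n, m; split; [split|]; auto.
Qed.

(** * Embeddings into quasigroups, topological groups and linear spaces *)

Definition seq_continuous2 {Y : Type} (op : topology Y) (f : Y -> Y -> Y) : Prop :=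
  forall u v x y, seq_converges op u x -> seq_converges op v y ->
    seq_converges op (fun k => f (u k) (v k)) (f x y).

(** Common form of (a), (b) and (c): the midpoint is not associative, but shares these division laws
    with a group product. The last hypothesis keeps in [M] the limit obtained on dividing by
    [y0]. *)
Lemma no_embedding_in_quasigroup {X Y : Type} (opX : topology X) (C V' : X -> Prop)
  (phi : V_carrier -> {x | V' x}) (opY : topology Y) (star ldiv rdiv : Y -> Y -> Y)
  (M : Y -> Prop) (h : X -> {y | M y}) :
  let y0 := proj1_sig (h (proj1_sig (phi V_inf))) in
  perfectly_normal opX -> sequential_space opX ->
  closed opX C -> homeomorphic (sub_open opX C) K_top ->
  is_homeomorphism V_top (sub_open opX V') phi ->
  continuous2 opY opY opY star -> seq_continuous2 opY ldiv -> seq_continuous2 opY rdiv ->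
  (forall x y, rdiv (star x y) y = x) ->
  (forall x y, ldiv x (star x y) = y) -> (forall x z, star x (ldiv x z) = z) ->
  (forall x y, M x -> M y -> M (star x y)) ->
  is_homeomorphism opX (sub_open opY M) h ->
  (forall u z, (forall k, M (u k)) -> M z ->
     seq_converges opY u (rdiv z y0) -> M (rdiv z y0)) ->
  False.
Proof.
  intros y0 pn sq HC HK Hphi cstar cl cr rK lK lK' HM Hh Hlim.
  pose proof (homeo_sub_converges _ _ _ _ Hh) as Hconv.
  destruct (Hh) as (g & gh & hg & ch & cg).
  set (e := fun x => proj1_sig (h x)).
  assert (eM : forall x, M (e x)) by (intros x; exact (proj2_sig (h x))).
  set (mu := fun x y => g (exist M (star (e x) (e y)) (HM _ _ (eM x) (eM y)))).
  assert (emu : forall x y, e (mu x y) = star (e x) (e y)).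
  { intros x y; unfold e at 1, mu; rewrite hg; reflexivity. }
  assert (Hmu : forall u v z, seq_converges opX (fun k => mu (u k) (v k)) z ->
            seq_converges opY (fun k => star (e (u k)) (e (v k))) (e z)).
  { intros u v z Hz; apply Hconv in Hz; fold (e z) in Hz.
    exact (seq_converges_ext _ _ _ _ (fun k => emu _ _) Hz). }
  apply (no_cancellative_operation opX C V' phi mu); auto.
  - intros x y W HW Wxy; destruct (cg W HW) as [W' [HW' E]].
    assert (E' : forall a, W a <-> W' (e a)).
    { intros a; unfold e; rewrite <- E, gh; tauto. }
    apply E' in Wxy; rewrite emu in Wxy.
    destruct (cstar _ _ W' HW' Wxy) as (U & V & HU & HV & Ux & Vy & H).
    exists (fun a => U (e a)), (fun a => V (e a)).
    split; [|split]; [apply (ch (fun b => U (proj1_sig b))); exists U; split; [auto|tauto]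
      |apply (ch (fun b => V (proj1_sig b))); exists V; split; [auto|tauto]|].
    repeat split; auto.
    intros x' y' Ux' Vy'; apply E'; rewrite emu; auto.
  - intros u v z Hz Hv; apply Hmu in Hz; apply Hconv in Hv.
    pose proof (cr _ _ _ _ Hz Hv) as Hu; cbv beta in Hu; fold y0 in Hu.
    apply (seq_converges_ext _ _ (fun k => e (u k)) _ (fun k => rK _ _)) in Hu.
    assert (Mw : M (rdiv (e z) y0)) by (eapply Hlim; [| |exact Hu]; intros; apply eM).
    exists (g (exist M _ Mw)); apply Hconv; rewrite hg; exact Hu.
  (* The limit [ldiv x z] of the right factors may lie outside [M]; multiplying it by [x] returns to
     [z], which is in [M]. *)
  - intros u v x z Hz Hu; apply Hmu in Hz; apply Hconv in Hu; apply Hconv.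
    pose proof (cl _ _ _ _ Hu Hz) as Hv; cbv beta in Hv.
    apply (seq_converges_ext _ _ (fun k => e (v k)) _ (fun k => lK _ _)) in Hv.
    pose proof (continuous2_seq _ _ _ _ _ _ _ _ cstar
                  (seq_converges_const opY (e x)) Hv) as Hx.
    rewrite lK' in Hx.
    refine (seq_converges_ext _ _ _ _ _ Hx); intros k; symmetry; apply emu.
  - intros v x y Hxy; apply Hmu in Hxy; rewrite emu in Hxy; apply Hconv.
    pose proof (cl _ _ _ _ (seq_converges_const opY (e x)) Hxy) as Hv.
    rewrite lK in Hv.
    apply (seq_converges_ext _ _ (fun k => e (v k)) _ (fun k => lK _ _)) in Hv.
    exact Hv.
Qed.

Lemma no_embedding_in_group {X G : Type} (opX : topology X) (C V' : X -> Prop)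
  (phi : V_carrier -> {x | V' x}) (mul : G -> G -> G) (one : G) (inv : G -> G)
  (opG : topology G) (M : G -> Prop) (h : X -> {g | M g}) :
  let y0 := proj1_sig (h (proj1_sig (phi V_inf))) in
  perfectly_normal opX -> sequential_space opX ->
  closed opX C -> homeomorphic (sub_open opX C) K_top ->
  is_homeomorphism V_top (sub_open opX V') phi ->
  is_topological_group mul one inv opG -> multiplicative mul M ->
  is_homeomorphism opX (sub_open opG M) h ->
  closed opG M \/ y0 = one ->
  False.
Proof.
  intros y0 pn sq HC HK Hphi [(asc & m1l & m1r & il & ir) (_ & cm & ci)] HM Hh Hcl.
  apply continuous2_curry in cm.
  assert (cis : forall u x, seq_converges opG u x ->
            seq_converges opG (fun k => inv (u k)) (inv x)).
  { intros u x Hu U HU Ux; exact (Hu _ (ci U HU) Ux). }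
  apply (no_embedding_in_quasigroup opX C V' phi opG mul
           (fun x z => mul (inv x) z) (fun z y => mul z (inv y)) M h); auto.
  - intros u v x y Hu Hv; apply (continuous2_seq _ _ _ _ _ _ _ _ cm); auto.
  - intros u v x y Hu Hv.
    apply (continuous2_seq _ _ _ _ _ (fun k => inv (v k)) _ _ cm); auto.
  - intros x y; rewrite <- asc, ir; auto.
  - intros x y; rewrite asc, il; auto.
  - intros x z; rewrite asc, ir; auto.
  (* For closed [M] the quotient is a limit of points of [M]; for [y0 = one] it is [z] itself. *)
  - fold y0; intros u z Mu Mz Hu; destruct Hcl as [Hcl|E].
    + eapply closed_seq; eauto.
    + assert (E1 : inv one = one) by (rewrite <- (m1l (inv one)) at 1; apply ir).
      rewrite E, E1, m1r; auto.
Qed.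

(** The midpoint operation is commutative, and the equation [star x y = z] is solved by
    [x = 2z - y], so one division serves on both sides. *)
Lemma no_embedding_as_convex {X L : Type} (opX : topology X) (C V' : X -> Prop)
  (phi : V_carrier -> {x | V' x}) (add : L -> L -> L) (zero : L) (opp : L -> L)
  (scal : R -> L -> L) (opL : topology L) (M : L -> Prop) (h : X -> {x | M x}) :
  perfectly_normal opX -> sequential_space opX ->
  closed opX C -> homeomorphic (sub_open opX C) K_top ->
  is_homeomorphism V_top (sub_open opX V') phi ->
  is_linear_topological_space add zero opp scal opL ->
  closed opL M -> convex add scal M ->
  is_homeomorphism opX (sub_open opL M) h ->
  False.
Proof.
  intros pn sq HC HK Hphi
    [(asc & com & a0 & aopp & sA & s1 & sDr & sDl) (_ & ca & cs)] Hcl Hcvx Hh.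
  apply continuous2_curry in ca; apply continuous2_curry in cs.
  set (star := fun x y => add (scal (1/2) x) (scal (1/2) y)).
  (* With [scal (-1)] in place of [opp], continuity of subtraction follows from that of scaling and
     addition. *)
  set (rdiv := fun z y => add (scal 2 z) (scal (-1) y)).
  assert (s0 : forall x, scal 0 x = zero).
  { intros x; assert (E : add (scal 0 x) (scal 0 x) = scal 0 x)
      by (rewrite <- sDl; f_equal; lra).
    rewrite <- (aopp (scal 0 x)); rewrite <- E at 3.
    rewrite asc, aopp, a0; reflexivity. }
  assert (rK : forall x y, rdiv (star x y) y = x).
  { intros x y; unfold rdiv, star.
    rewrite sDr, !sA, <- asc, <- sDl.
    replace (2 * (1 / 2)) with 1 by lra; replace (1 + -1) with 0 by lra.
    rewrite s0, com, a0, s1; reflexivity. }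
  assert (starC : forall x y, star x y = star y x) by (intros; apply com).
  assert (cr : seq_continuous2 opL rdiv).
  { intros u v x y Hu Hv.
    apply (continuous2_seq _ _ _ _ (fun k => scal 2 (u k)) (fun k => scal (-1) (v k)) _ _ ca);
      apply (continuous2_seq _ _ _ _ (fun _ => _) _ _ _ cs); auto;
      apply seq_converges_const. }
  apply (no_embedding_in_quasigroup opX C V' phi opL star
           (fun x z => rdiv z x) rdiv M h); auto.
  - intros x y W HW Wxy.
    destruct (ca _ _ W HW Wxy) as (U & V & HU & HV & Ux & Vy & H).
    destruct (cs _ _ U HU Ux) as (I & P & HI & HP & I2 & Px & H1).
    destruct (cs _ _ V HV Vy) as (J & Q & HJ & HQ & J2 & Qy & H2).
    exists P, Q; repeat split; auto.
    intros x' y' Hx' Hy'; apply H; auto.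
  - intros u v x y Hu Hv; apply cr; auto.
  - intros x y; rewrite starC; apply rK.
  - intros x z; unfold star, rdiv.
    rewrite sDr, !sA, (com (scal (1 / 2 * 2) z)), asc, <- sDl.
    replace (1 / 2 * 2) with 1 by lra; replace (1 / 2 + 1 / 2 * -1) with 0 by lra.
    rewrite s0, a0, s1; reflexivity.
  (* The second coefficient is rewritten to match [convex] at [t = 1/2]. *)
  - intros x y Mx My; unfold star; replace (1/2) with (1 - 1/2) at 2 by lra.
    apply Hcvx; auto; lra.
  - intros u z Mu Mz Hu; eapply closed_seq; eauto.
Qed.

Theorem theorem2 (X : Type) (opX : topology X) (topX : is_topology opX)
  (pnX : perfectly_normal opX) (seqX : sequential_space opX)
  (hK : exists C : X -> Prop, closed opX C /\ homeomorphic (sub_open opX C) K_top)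
  (V' : X -> Prop) (phi : V_carrier -> {x | V' x})
  (hphi : is_homeomorphism V_top (sub_open opX V') phi) :
  let y0' : X := proj1_sig (phi V_inf) in
  (* (a) *)
  (forall (L : Type) (add : L -> L -> L) (zero : L) (opp : L -> L)
          (scal : R -> L -> L) (opL : topology L),
      is_linear_topological_space add zero opp scal opL ->
      forall C : L -> Prop, closed opL C -> convex add scal C ->
      ~ homeomorphic opX (sub_open opL C)) /\
  (* (b) *)
  (forall (G : Type) (mul : G -> G -> G) (one : G) (inv : G -> G) (opG : topology G),
      is_topological_group mul one inv opG ->
      forall M : G -> Prop, closed opG M -> multiplicative mul M ->
      ~ homeomorphic opX (sub_open opG M)) /\
  (* (c) *)
  (forall (G : Type) (mul : G -> G -> G) (one : G) (inv : G -> G) (opG : topology G),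
      is_topological_group mul one inv opG ->
      forall M : G -> Prop, multiplicative mul M ->
      ~ (exists h : X -> {g | M g},
           is_homeomorphism opX (sub_open opG M) h /\ proj1_sig (h y0') = one)).
Proof.
  destruct hK as (C & HC & HK); intros y0'; split; [|split].
  - intros L add zero opp scal opL HL M HM Hcvx [h Hh].
    eapply no_embedding_as_convex; eauto.
  - intros G mul one inv opG HG M HM Hmul [h Hh].
    eapply no_embedding_in_group; eauto.
  - intros G mul one inv opG HG M Hmul [h [Hh E]].
    eapply no_embedding_in_group; eauto.
Qed.
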